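(* Let $r>0$ and $0<p<1$. For conditional negative binomial approximation by $\mathrm{NB}^{(m)}(r,p)$, both Stein's factors $G_{m,1}$ and $G_{m,2}$ are decreasing in $m\in\{0,1,2,\ldots\}$.
   Context: ''Decreasing'' is meant in the weak sense (non-increasing). $\mathrm{NB}(r,p)$ is the distribution with $\mathbb{P}(Z=k)=\frac{\Gamma(r+k)}{\Gamma(r)k!}(1-p)^rp^k$, $k=0,1,2,\ldots$. For a non-negative integer $m$, $\mathbb{Z}_m:=\{m,m+1,\ldots\}$, $\mathrm{NB}^{(m)}(r,p):=\mathcal{L}(Z\mid Z\ge m)$ with $Z\sim\mathrm{NB}(r,p)$, and $\mathrm{NB}^{(m)}(r,p)\{f\}:=\mathbb{E}[f(Z)\mid Z\ge m]$. Let $\mathcal{F}_m:=\{\mathbf{1}_A:A\subset\mathbb{Z}_m\}$. For $f\in\mathcal{F}_m$, $g_{m,f}$ is the solution on $\mathbb{Z}_m$ (unique except at $i=m$) of Stein's equation $$p(r+i)g_{m,f}(i+1)-i\,g_{m,f}(i)\mathbf{1}_{i>m}=f(i)-\mathrm{NB}^{(m)}(r,p)\{f\},\qquad i\in\mathbb{Z}_m.$$ For a function $h$ on $\mathbb{Z}_m$, $\Delta h(i)=h(i+1)-h(i)$ and $\|h\|_m:=\sup_{w\in\mathbb{Z}_m}|h(w+1)|$. Define $G_{m,1}:=\sup_{f\in\mathcal{F}_m}\|g_{m,f}\|_m$ and $G_{m,2}:=\sup_{f\in\mathcal{F}_m}\|\Delta g_{m,f}\|_m$. *)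

(* Defs.v *)
From HB Require Import structures.
From mathcomp Require Import all_boot all_order all_algebra.
From mathcomp Require Import all_classical all_reals all_analysis.

Set Implicit Arguments.
Unset Strict Implicit.
Unset Printing Implicit Defensive.

Import Order.TTheory GRing.Theory Num.Theory.
Import numFieldNormedType.Exports.

Local Open Scope classical_set_scope.
Local Open Scope ring_scope.

(* Euler's Gamma function, meaningful for 0 < s. *)
Definition Gamma {R : realType} (s : R) : R :=
  \int[lebesgue_measure]_(x in `]0, +oo[) (x `^ (s - 1) * expR (- x)).

Definition nb_pmf {R : realType} (r p : R) (k : nat) : R :=
  Gamma (r + k%:R) / (Gamma r * k`!%:R) * (1 - p) `^ r * p ^+ k.

Lemma Gamma_ge0 {R : realType} (s : R) : 0 <= Gamma s.
Proof. by apply: Rintegral_ge0 => x _; rewrite mulr_ge0 ?powR_ge0 ?expR_ge0. Qed.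

Lemma nb_pmf_ge0 {R : realType} (r p : R) k : 0 <= p -> 0 <= nb_pmf r p k.
Proof.
move=> p0; rewrite /nb_pmf !mulr_ge0 ?invr_ge0 ?mulr_ge0 ?Gamma_ge0 ?powR_ge0//.
exact: exprn_ge0.
Qed.

(* The law NB(r, p) on nat; outside the parameter range 0 < r, 0 < p < 1 the
   value is a dummy, so that the measure structure is unconditional. *)
Definition nb_law {R : realType} (r p : R) : set nat -> \bar R :=
  fun U => if (0 < r) && (0 < p < 1) then \esum_(k in U) (nb_pmf r p k)%:E
           else \d_0%N U.

Section nb_law.
Context {R : realType} (r p : R).
Local Open Scope ereal_scope.

Let nb_law0 : nb_law r p set0 = 0.
Proof. by rewrite /nb_law measure0; case: ifPn => //; rewrite esum_set0. Qed.

Let nb_law_ge0 U : 0 <= nb_law r p U.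
Proof.
rewrite /nb_law; case: ifPn => // /and3P[_ /ltW p0 _].
by apply: esum_ge0 => /= n _; rewrite lee_fin nb_pmf_ge0.
Qed.

Let nb_law_sigma_additive : semi_sigma_additive (nb_law r p).
Proof.
move=> F mF tF mUF; rewrite /nb_law; case: ifPn => [/and3P[_ /ltW p0 _]|_].
  have pmf0 k : 0 <= (nb_pmf r p k)%:E by rewrite lee_fin nb_pmf_ge0.
  apply: cvg_toP; last by rewrite nneseries_sum_bigcup.
  apply: ereal_nondecreasing_is_cvgn => a b ab.
  by apply: lee_sum_nneg_natr => // n _ _; apply: esum_ge0.
exact: measure_semi_sigma_additive.
Qed.

HB.instance Definition _ := isMeasure.Build _ _ _ (nb_law r p)
  nb_law0 nb_law_ge0 nb_law_sigma_additive.

End nb_law.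

Definition Zge (m : nat) : set nat := [set i | (m <= i)%N].

Lemma measurable_Zge m : measurable (Zge m).
Proof. by []. Qed.

(* The conditional law of Z given Z >= m, i.e. NB(r, p) restricted to Zge m and
   divided by its mass.  The second argument of [mnormalize] is only used if
   that mass is 0 or +oo, which does not happen for 0 < r and 0 < p < 1. *)
Definition nb_cond {R : realType} (r p : R) (m : nat) : probability nat R :=
  mnormalize (mrestr (nb_law r p) (measurable_Zge m)) \d_m.

Definition nb_cond_mean {R : realType} (r p : R) (m : nat) (f : nat -> R) : R :=
  fine ('E_(nb_cond r p m)[f])%E.

(* Functions on Zge m are represented by functions on nat, whose values below m
   are never used. *)
Definition indicators {R : realType} (m : nat) : set (nat -> R) :=
  [set \1_A | A in [set A : set nat | A `<=` Zge m]].

Definition stein_solution {R : realType} (r p : R) (m : nat) (f g : nat -> R) :=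
  forall i, Zge m i ->
    p * (r + i%:R) * g i.+1 - i%:R * g i * (m < i)%N%:R
      = f i - nb_cond_mean r p m f.

Definition fdiff {R : realType} (h : nat -> R) : nat -> R :=
  fun i => h i.+1 - h i.

(* The point m itself is not involved, so the arbitrary value g m of a solution
   of Stein's equation plays no role below. *)
Definition shift_norm {R : realType} (m : nat) (h : nat -> R) : \bar R :=
  ereal_sup [set `|h w.+1|%:E | w in Zge m].

Lemma stein_solution_exists {R : realType} (r p : R) m f :
  0 < r -> 0 < p -> exists g, stein_solution r p m f g.
Proof.
move=> r0 p0.
pose c := nb_cond_mean r p m f.
pose g := fix g i := if i is j.+1 then
  (f j - c + j%:R * g j * (m < j)%N%:R) / (p * (r + j%:R)) else 0.
exists g => i _ /=; rewrite mulrC divfK ?addrK//.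
by rewrite gt_eqF// mulr_gt0// ltr_wpDr.
Qed.

Lemma stein_solution_unique {R : realType} (r p : R) m f g h :
  0 < r -> 0 < p -> stein_solution r p m f g -> stein_solution r p m f h ->
  forall i, (m < i)%N -> g i = h i.
Proof.
move=> r0 p0 gP hP; elim=> // i IH; rewrite ltnS => mi.
have c0 : p * (r + i%:R) != 0 by rewrite gt_eqF// mulr_gt0// ltr_wpDr.
apply: (mulfI c0); have := gP i mi; rewrite -(hP i mi).
have [lt_mi|_] := boolP (m < i)%N; last by rewrite !mulr0 !subr0.
by rewrite IH// => /addIr.
Qed.

Definition stein_factor1 {R : realType} (r p : R) (m : nat) : \bar R :=
  ereal_sup [set shift_norm m g | g in
    [set g | exists2 f, indicators m f & stein_solution r p m f g]].

Definition stein_factor2 {R : realType} (r p : R) (m : nat) : \bar R :=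
  ereal_sup [set shift_norm m (fdiff g) | g in
    [set g | exists2 f, indicators m f & stein_solution r p m f g]].

(* Main.v *)
Require Import Defs.
From mathcomp Require Import all_boot all_order all_algebra.
From mathcomp Require Import all_classical all_reals all_analysis.
From mathcomp Require Import measurable_realfun ring lra.

Import Order.TTheory GRing.Theory Num.Theory.
Import numFieldNormedType.Exports.
Local Open Scope classical_set_scope.
Local Open Scope ring_scope.

(** Write w k for the weight of NB(r, p) at k and T i for its mass on
    {i, i+1, ...}.  The weights satisfy the detailed balance
    (k+1) w(k+1) = p (r+k) w k, so multiplying Stein's equation by w turns it
    into a telescoping sum: for f the indicator of A and i > m,
    i w(i) g(i) = P(A) T(i) / T(m) - P(A and [i, oo)).

    For the first factor, the right-hand side has modulus at most
    (T(m) - T(i)) T(i) / T(m), with equality for A = [i, oo).  So the factor is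
    the supremum over i > m of (1 - T(i)/T(m)) T(i) / (i w(i)), and raising m
    both shrinks the range of i and lowers every term.

    For the second factor, split A into its parts before i, at i and after i.
    The difference g(i+1) - g(i) is linear in the masses of the three parts,
    and two monotonicity facts fix the signs of the coefficients:
    T(i+1) / (p (r+i)) <= T(i) / i  ([tail_death_birth]) and
    (T(m) - T(i)) / i <= (T(m) - T(i+1)) / (p (r+i))  ([head_birth_death]).
    Only the part at i contributes positively, so A = {i} is extremal from above
    and its complement from below, with opposite values because the difference
    vanishes for A = [m, oo).  The factor is thus the supremum over i > m of
    1/i - (T(i)/i - T(i+1)/(p (r+i))) / T(m); the bracket is nonnegative by the
    first fact, so each term again decreases in m.

    The balance relation itself rests on Gamma(s+1) = s Gamma(s), proved by
    integrating the derivative of x^s exp(-x) over compact intervals exhausting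
    the half-line.  Summability of the weights also comes from the balance
    relation, through the identity it gives between the zeroth and first
    moments. *)

(** * Euler's Gamma function *)

Section Gamma.
Set Implicit Arguments.
Unset Strict Implicit.
Context {R : realType}.
Implicit Types s x : R.
Local Notation mu := (@lebesgue_measure R).

(** The concavity bound ln y <= y - 1 at y = x / (2 s) trades the power for half
    of the exponential decay.  It serves both as an integrable majorant and to
    kill the boundary term at infinity. *)
Lemma powR_expRN_le s x : 0 < s -> 0 < x ->
  x `^ s * expR (- x) <= (2 * s) `^ s * expR (- (x / 2)).
Proof.
move=> s0 x0; have s20 : 0 < 2 * s by rewrite mulr_gt0.
have xs0 : 0 < x / (2 * s) by rewrite divr_gt0.
rewrite /powR !gt_eqF// -!expRD ler_expR.
have -> : ln x = ln (x / (2 * s)) + ln (2 * s).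
  by rewrite -lnM ?posrE// divfK// gt_eqF.
have := expR_ge1Dx (ln (x / (2 * s))); rewrite lnK ?posrE// => h.
have : s * ln (x / (2 * s)) <= s * (x / (2 * s) - 1).
  by rewrite ler_pM2l// lerBrDl.
have -> : s * (x / (2 * s) - 1) = x / 2 - s by field; rewrite gt_eqF.
rewrite mulrDr; lra.
Qed.

Lemma is_derive_powR_expRN s x : 0 < x ->
  is_derive x 1 (fun y : R => y `^ s * expR (- y))
    (s * (x `^ (s - 1) * expR (- x)) - x `^ s * expR (- x)).
Proof.
move=> x0; have := is_derive1_powR s x0 => h.
apply: is_derive_eq.
by rewrite /GRing.scale /=; ring.
Qed.

Lemma continuous_powR_expRN s x : 0 < x ->
  {for x, continuous (fun y : R => y `^ s * expR (- y))}.
Proof.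
move=> x0; have := is_derive_powR_expRN s x0 => h.
by apply/differentiable_continuous/derivable1_diffP.
Qed.

Lemma measurable_powR_expRN s (D : set R) :
  measurable_fun D (fun x : R => x `^ s * expR (- x)).
Proof.
apply: measurable_funTS; apply: measurable_funM.
  exact: measurable_powR.
exact: measurableT_comp.
Qed.

Lemma integrable_powR_expRN s : 0 < s ->
  mu.-integrable `]0, +oo[ (EFin \o (fun x : R => x `^ s * expR (- x))).
Proof.
move=> s0.
pose C : R := (2 * s) `^ s.
have h2 : 0 < 2^-1 :> R by rewrite invr_gt0.
(* The majorant C exp(-x/2) is 2 C times the exponential density of rate 1/2. *)
apply: (@le_integrable _ _ _ mu _ (measurable_itv _) _
  (EFin \o (fun x => 2 * C * exponential_pdf 2^-1 x))).
- apply/measurable_EFinP; exact: measurable_powR_expRN.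
- move=> x; rewrite /= in_itv/= andbT => x0.
  rewrite lee_fin ger0_norm ?mulr_ge0 ?powR_ge0 ?expR_ge0//.
  apply: le_trans (ler_norm _).
  apply: (le_trans (powR_expRN_le s0 x0)).
  rewrite (exponential_pdfE _ (ltW x0)).
  by rewrite mulrCA mulrA mulrA mulVf// mul1r mulNr (mulrC x).
- apply: (@integrableS _ _ _ mu setT) => //.
  have := @integrableZl _ _ _ mu setT measurableT (2 * C) _
    (integrable_exponential_pdf h2).
  by [].
Qed.

(** Compact intervals inside the open half-line: the integrand may blow up at 0,
    so both ends have to be approached. *)
Definition expanding n : set R := `[n.+2%:R^-1, n.+2%:R].

Lemma measurable_expanding n : measurable (expanding n).
Proof. exact: measurable_itv. Qed.

Lemma bigcup_expanding : \bigcup_n expanding n = `]0, +oo[%classic.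
Proof.
apply/seteqP; split => x /=.
  by move=> [n _]; rewrite /expanding /= !in_itv/= andbT => /andP[+ _]; apply: lt_le_trans.
rewrite in_itv/= andbT => x0.
pose n := Num.truncn (x + x^-1).
have xn : x + x^-1 < n.+1%:R.
  by rewrite truncnS_gt.
have xi0 : 0 < x^-1 by rewrite invr_gt0.
have n12 : n.+1%:R <= n.+2%:R :> R by rewrite ler_nat.
exists n => //; rewrite /expanding /= in_itv/=; apply/andP; split; last by lra.
by rewrite invf_ple ?posrE//; lra.
Qed.

Lemma expanding_homo : {homo expanding : n m / (n <= m)%N >-> (n <= m)%O}.
Proof.
move=> n m nm; apply/subsetPset; apply: subset_itv; rewrite bnd_simp.
  by rewrite lef_pV2 ?posrE// ler_nat.
by rewrite ler_nat.
Qed.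

Lemma expanding_gt0 n x : x \in `[n.+2%:R^-1, n.+2%:R] -> 0 < x.
Proof. by rewrite in_itv/= => /andP[+ _]; apply: lt_le_trans; rewrite invr_gt0. Qed.

Lemma integrable_expanding s n :
  mu.-integrable (expanding n) (EFin \o (fun x => x `^ s * expR (- x))).
Proof.
apply: continuous_compact_integrable; first exact: segment_compact.
apply: derivable_within_continuous => x /expanding_gt0 x0.
by have [] := is_derive_powR_expRN s x0.
Qed.

(** The derivative of x^s exp(-x) is s x^(s-1) exp(-x) - x^s exp(-x); on a
    compact interval this is the functional equation up to boundary terms. *)
Lemma integral_expanding_by_parts s n : 0 < s ->
  s * (\int[mu]_(x in expanding n) (x `^ (s - 1) * expR (- x))) =
  n.+2%:R `^ s * expR (- n.+2%:R) - n.+2%:R^-1 `^ s * expR (- n.+2%:R^-1)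
  + \int[mu]_(x in expanding n) (x `^ s * expR (- x)).
Proof.
move=> s0.
have ab : n.+2%:R^-1 < n.+2%:R :> R.
  by rewrite invf_plt ?posrE// (@le_lt_trans _ _ 1) ?invf_le1 ?ler1n// ltr1n.
have pos := @expanding_gt0 n.
have int t := integrable_expanding t n.
have E := @continuous_FTC2 R
  (fun x => s * (x `^ (s - 1) * expR (- x)) - x `^ s * expR (- x))
  (fun x => x `^ s * expR (- x)) _ _ ab.
have : \int[mu]_(x in expanding n) (s * (x `^ (s - 1) * expR (- x)) - x `^ s * expR (- x))
   = n.+2%:R `^ s * expR (- n.+2%:R) - n.+2%:R^-1 `^ s * expR (- n.+2%:R^-1).
  rewrite /Rintegral /expanding E//.
  - apply: derivable_within_continuous => x /pos x0.
    apply: derivableB; first apply: derivableM => //.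
      by have [] := is_derive_powR_expRN (s - 1) x0.
    by have [] := is_derive_powR_expRN s x0.
  - split.
    + move=> x xab; have x0 : 0 < x by apply: pos; exact: subset_itv_oo_cc xab.
      by have [] := is_derive_powR_expRN s x0.
    + apply: cvg_at_right_filter; apply: continuous_powR_expRN.
      by rewrite invr_gt0.
    + by apply: cvg_at_left_filter; apply: continuous_powR_expRN.
  - move=> x xab; have x0 : 0 < x by apply: pos; exact: subset_itv_oo_cc xab.
    by rewrite derive1E; have [_ ->] := is_derive_powR_expRN s x0.
move=> <-.
rewrite RintegralB//=; first last.
- by have := @integrableZl _ _ _ mu _ (@measurable_expanding n) s _ (int (s - 1)).
- exact: measurable_expanding.
rewrite subrK RintegralZl//=; exact: measurable_expanding.
Qed.

(** The bound for the exponent s + 1 leaves a spare factor 1 / (n + 2). *)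
Lemma cvg_powR_expRN s : 0 < s ->
  n.+2%:R `^ s * expR (- n.+2%:R) @[n --> \oo] --> (0 : R).
Proof.
move=> s0.
pose C : R := (2 * (s + 1)) `^ (s + 1).
have C0 : 0 <= C by exact: powR_ge0.
apply: (@squeeze_cvgr _ _ _ _ (fun=> 0) (fun n => C * n.+1%:R^-1)).
- near=> n; rewrite mulr_ge0 ?powR_ge0 ?expR_ge0//=.
  have n0 : 0 < n.+2%:R :> R by [].
  have := powR_expRN_le (addr_gt0 s0 ltr01) n0; rewrite -/C => h.
  have {}h : n.+2%:R `^ (s + 1) * expR (- n.+2%:R) <= C.
    by rewrite (le_trans h)// ler_piMr// -[leRHS]expR0 ler_expR.
  have -> : n.+2%:R `^ s * expR (- n.+2%:R) =
      n.+2%:R `^ (s + 1) * expR (- n.+2%:R) / n.+2%:R.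
    rewrite powRD; last by apply/implyP => _; rewrite gt_eqF.
    by rewrite powRr1//; field; rewrite -(natrD _ 2) addnC.
  rewrite (le_trans (ler_wpM2r _ h))// ?invr_ge0//.
  by rewrite ler_wpM2l// lef_pV2 ?posrE// ler_nat.
- exact: cvg_cst.
- by rewrite -(mulr0 C); apply: cvgM; [exact: cvg_cst|exact: cvg_harmonic].
Unshelve. all: by end_near. Qed.

Lemma cvg_powR_expRN0 s : 0 < s ->
  n.+2%:R^-1 `^ s * expR (- n.+2%:R^-1) @[n --> \oo] --> (0 : R).
Proof.
move=> s0.
have h : n.+2%:R^-1 @[n --> \oo] --> (0:R).
  by have := @cvg_harmonic R; rewrite -cvg_shiftS.
rewrite -[X in _ --> X](mul0r (expR (- (0 : R)))); apply: cvgM.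
  by move/cvg_at_rightP: (powR_cvg0 s0); apply; split.
by apply: continuous_cvg; [exact: continuous_expR|exact: cvgN].
Qed.

Lemma cvg_integral_expanding s :
  (\int[mu]_(x in expanding n) (x `^ s * expR (- x))%:E)%E @[n --> \oo] -->
  (\int[mu]_(x in `]0%R, +oo[) (x `^ s * expR (- x))%:E)%E.
Proof.
rewrite -bigcup_expanding; apply: ge0_nondecreasing_set_cvg_integral.
- exact: expanding_homo.
- exact: measurable_expanding.
- by move=> n; apply/measurable_EFinP; exact: measurable_powR_expRN.
- by move=> n x _; rewrite lee_fin mulr_ge0 ?powR_ge0 ?expR_ge0.
Qed.

(** [Gamma (s + 1)] is a finite integral because x^s exp(-x) is integrable.
    Passing to the limit in the integration by parts transfers this finiteness
    to the exponent s - 1, even when it lies in (-1, 0) and the integrand is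
    unbounded at 0. *)
Lemma integral_powR_expRN s : 0 < s ->
  (\int[mu]_(x in `]0%R, +oo[) (x `^ (s - 1) * expR (- x))%:E)%E =
  (s^-1 * Gamma (s + 1))%:E.
Proof.
move=> s0.
have fin t n : (\int[mu]_(x in expanding n) (x `^ t * expR (- x))%:E)%E \is a fin_num.
  by apply: integrable_fin_num (integrable_expanding t n); exact: measurable_expanding.
have GE : (Gamma (s + 1))%:E =
    (\int[mu]_(x in `]0%R, +oo[) (x `^ s * expR (- x))%:E)%E.
  rewrite /Gamma /Rintegral addrK fineK//.
  by apply: integrable_fin_num => //; exact: integrable_powR_expRN.
have h : \int[mu]_(x in expanding n) (x `^ s * expR (- x)) @[n --> \oo]
    --> Gamma (s + 1).
  by have := @cvg_integral_expanding s; rewrite -GE => /fine_cvg.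
have h2 : \int[mu]_(x in expanding n) (x `^ (s - 1) * expR (- x)) @[n --> \oo]
    --> s^-1 * Gamma (s + 1).
  rewrite (_ : (fun n => _) = fun n => s^-1 * (n.+2%:R `^ s * expR (- n.+2%:R)
      - n.+2%:R^-1 `^ s * expR (- n.+2%:R^-1)
      + \int[mu]_(x in expanding n) (x `^ s * expR (- x)))); last first.
    by apply/funext => n; rewrite -integral_expanding_by_parts// mulKf ?gt_eqF.
  apply: cvgM; first exact: cvg_cst.
  rewrite -[X in _ --> X](add0r (Gamma _)); apply: cvgD => //.
  rewrite -[X in _ --> X](subr0 0); apply: cvgB.
    exact: cvg_powR_expRN.
  exact: cvg_powR_expRN0.
apply: (cvg_unique _ (@cvg_integral_expanding (s - 1))); first exact: ereal_hausdorff.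
by apply: cvg_EFin h2; apply: nearW => n; exact: fin.
Qed.

Lemma GammaS s : 0 < s -> Gamma (s + 1) = s * Gamma s.
Proof.
move=> s0; rewrite [in RHS]/Gamma /Rintegral integral_powR_expRN//=.
by rewrite mulVKf ?gt_eqF.
Qed.

(** By the functional equation it is enough to treat s + 1, whose integrand is at
    least exp(-2) on [1, 2]. *)
Lemma Gamma_gt0 s : 0 < s -> 0 < Gamma s.
Proof.
move=> s0; suff : 0 < Gamma (s + 1) by rewrite GammaS// pmulr_rgt0.
apply: (@lt_le_trans _ _ (expR (- 2))); first exact: expR_gt0.
rewrite -lee_fin /Gamma /Rintegral addrK fineK; last first.
  by apply: integrable_fin_num => //; exact: integrable_powR_expRN.
have m12 := @measurable_itv R `[1, 2]%R.
have -> : (expR (- 2))%:E =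
    (\int[mu]_(x in `[1%R, 2%R]) cst (expR (- 2))%:E x)%E.
  rewrite integral_cst//= lebesgue_measure_itv /= lte_fin ltr1n/=.
  by rewrite -EFinD (_ : 2 - 1 = 1) ?mule1//; ring.
apply: (@le_trans _ _ (\int[mu]_(x in `[1%R, 2%R]) (x `^ s * expR (- x))%:E)%E).
  apply: ge0_le_integral => //.
  - by move=> x _; rewrite lee_fin expR_ge0.
  - by apply/measurable_EFinP; exact: measurable_powR_expRN.
  - move=> x /=; rewrite in_itv/= => /andP[x1 x2].
    rewrite lee_fin -[leLHS]mul1r ler_pM ?expR_ge0//; last first.
      by rewrite ler_expR lerN2.
    by rewrite -(powRr0 x) ler_powR// ltW.
apply: ge0_subset_integral => //.
- by apply/measurable_EFinP; exact: measurable_powR_expRN.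
- by move=> x _; rewrite lee_fin mulr_ge0 ?powR_ge0 ?expR_ge0.
- by apply: subset_itv; rewrite bnd_simp.
Qed.

End Gamma.

(** * The negative binomial law: detailed balance and tails *)

Section NegativeBinomial.
Set Implicit Arguments.
Unset Strict Implicit.
Context {R : realType} (r p : R).
Hypotheses (r0 : 0 < r) (p0 : 0 < p) (p1 : p < 1).
Implicit Types (A : set nat) (i j k m n : nat).
Local Notation w := (nb_pmf r p).

Lemma nb_pmf_gt0 k : 0 < w k.
Proof.
have rk : 0 < r + k%:R by rewrite ltr_wpDr.
have k0 : 0 < k`!%:R :> R by rewrite ltr0n fact_gt0.
by rewrite /nb_pmf !mulr_gt0 ?invr_gt0 ?mulr_gt0 ?Gamma_gt0 ?powR_gt0 ?exprn_gt0 ?subr_gt0.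
Qed.

(** Detailed balance for birth rates p (r + k) and death rates k. *)
Lemma nb_pmfS k : k.+1%:R * w k.+1 = p * (r + k%:R) * w k.
Proof.
have k0 : k`!%:R != 0 :> R by rewrite pnatr_eq0 -lt0n fact_gt0.
have G0 : Gamma r != 0 by rewrite gt_eqF// Gamma_gt0.
have S0 : k.+1%:R != 0 :> R by rewrite pnatr_eq0.
have -> : w k.+1 = Gamma (r + k%:R + 1) / (Gamma r * (k.+1%:R * k`!%:R))
     * (1 - p) `^ r * (p * p ^+ k).
  by rewrite /nb_pmf factS natrM exprS -natr1 addrA.
rewrite GammaS ?ltr_wpDr// /nb_pmf.
by field; rewrite G0 k0 addrC natr1.
Qed.

(** Summing the detailed balance relation over k < n. *)
Lemma sum_nb_pmf_moment n :
  (1 - p) * \sum_(0 <= k < n) k%:R * w k + n%:R * w n = p * r * \sum_(0 <= k < n) w k.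
Proof.
elim: n => [|n IH]; first by rewrite !big_geq// !mulr0 mul0r addr0.
rewrite !big_nat_recr//= nb_pmfS !mulrDr -IH; ring.
Qed.

(** The truncated first moment is at most p r / (1 - p) times the truncated mass.
    By Markov's inequality at a level K of at least twice this constant, at most
    half of the truncated mass lies at or above K. *)
Lemma sum_nb_pmf_bounded : exists C : R, forall n, \sum_(0 <= k < n) w k <= C.
Proof.
pose K : nat := (Num.truncn (2 * (p * r / (1 - p)))).+1.
have K0 : 0 < K%:R :> R by [].
have q0 : 0 < 1 - p by rewrite subr_gt0.
have hK : 2 * (p * r / (1 - p)) < K%:R by exact: truncnS_gt.
exists (2 * \sum_(0 <= k < K) w k) => n.
have w0 k : 0 <= w k by exact/ltW/nb_pmf_gt0.
have hM : 2 * \sum_(0 <= k < n) k%:R * w k <= K%:R * \sum_(0 <= k < n) w k.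
  have -> : 2 * \sum_(0 <= k < n) k%:R * w k =
     2 * (p * r / (1 - p)) * \sum_(0 <= k < n) w k - 2 * (n%:R * w n) / (1 - p).
    apply: (mulfI (lt0r_neq0 q0)).
    rewrite mulrCA (_ : _ * \sum_(0 <= k < n) _ = p * r * \sum_(0 <= k < n) w k - n%:R * w n).
      by field; rewrite gt_eqF.
    by rewrite -sum_nb_pmf_moment addrK.
  rewrite lerBlDr (@le_trans _ _ (K%:R * \sum_(0 <= k < n) w k))//.
    by apply: ler_wpM2r (ltW hK); apply: sumr_ge0.
  by rewrite lerDl divr_ge0 ?(ltW q0)// mulr_ge0// mulr_ge0.
(* Markov's inequality at level K. *)
have hS : K%:R * \sum_(0 <= k < n) w k <=
    K%:R * \sum_(0 <= k < K) w k + \sum_(0 <= k < n) k%:R * w k.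
  have [nK|Kn] := leqP n K.
    rewrite (@le_trans _ _ (K%:R * \sum_(0 <= k < K) w k))//.
      rewrite ler_wpM2l// (big_cat_nat _ nK)//= lerDl.
      by apply: sumr_ge0.
    by rewrite lerDl sumr_ge0// => k _; rewrite mulr_ge0.
  rewrite (@big_cat_nat _ _ _ K 0 n)//= 1?ltnW// mulrDr lerD2l.
  rewrite [leRHS](@big_cat_nat _ _ _ K 0 n)//= 1?ltnW//.
  apply: ler_wpDl; first by apply: sumr_ge0 => k _; rewrite mulr_ge0.
  rewrite mulr_sumr; apply: ler_sum_nat => k /andP[Kk _].
  by rewrite ler_wpM2r// ler_nat.
rewrite -(ler_pM2l K0) mulrCA. lra.
Qed.

Lemma nb_lawE A : nb_law r p A = (\esum_(k in A) (w k)%:E)%E.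
Proof. by rewrite /nb_law r0 p0 p1. Qed.

Lemma nb_law_fin A : nb_law r p A \is a fin_num.
Proof.
rewrite ge0_fin_numE//.
have [C hC] := sum_nb_pmf_bounded.
apply: (@le_lt_trans _ _ C%:E); last exact: ltry.
apply: (@le_trans _ _ (nb_law r p setT)); first by apply: le_measure; rewrite ?inE.
rewrite nb_lawE -nneseries_esumT => [|n]; last by rewrite lee_fin ltW ?nb_pmf_gt0.
apply: lime_le.
  by apply: is_cvg_nneseries => n _ _; rewrite lee_fin ltW ?nb_pmf_gt0.
by apply: nearW => n; rewrite sumEFin lee_fin.
Qed.

(** Since the total mass is finite, real-valued masses lose nothing. *)
Definition mass A : R := fine (nb_law r p A).

Lemma massE A : (mass A)%:E = nb_law r p A.
Proof. by rewrite fineK ?nb_law_fin. Qed.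

Lemma mass_ge0 A : 0 <= mass A.
Proof. by rewrite fine_ge0. Qed.

(** For A everything this is the recursion of the tails; in general the increment
    is the source term w(i) f(i) of the weighted Stein equation. *)
Lemma mass_capS A i : mass (A `&` Zge i) = w i * \1_A i + mass (A `&` Zge i.+1).
Proof.
apply: EFin_inj; rewrite EFinD !massE.
have -> : nb_law r p (A `&` Zge i) = (nb_law r p ((A `&` Zge i) `\` Zge i.+1)
    + nb_law r p (A `&` Zge i.+1))%E.
  have <- : (A `&` Zge i) `&` Zge i.+1 = A `&` Zge i.+1.
    by rewrite -setIA; congr (_ `&` _); apply: setIidr => k; exact: ltnW.
  exact: measureDI.
congr (_ + _)%E.
have iE k : ((i <= k)%N /\ ~ (i < k)%N) <-> k = i.
  split => [[ik]|->]; last by rewrite leqnn ltnn.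
  by move/negP; rewrite -leqNgt => ki; apply/eqP; rewrite eqn_leq ki.
rewrite nb_lawE indicE; case: (boolP (i \in A)) => [/set_mem Ai|/negP iA].
  rewrite mulr1 (_ : _ `\` _ = [set i]) ?esum_set1 ?lee_fin ?ltW ?nb_pmf_gt0//.
  apply/seteqP; split => k /=; first by case=> -[_ h1] h2; exact/iE.
  by move=> ->; rewrite /Zge/= leqnn ltnn.
rewrite mulr0 (_ : _ `\` _ = set0) ?esum_set0//.
apply/seteqP; split => k //= -[[Ak h1] h2].
have /iE ki : (i <= k)%N /\ ~ (i < k)%N by [].
by apply: iA; rewrite inE -ki.
Qed.

Definition tail i := mass (Zge i).

Lemma tailS i : tail i = w i + tail i.+1.
Proof. by have := mass_capS setT i; rewrite !setTI indicT mulr1. Qed.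

Lemma tail_gt0 i : 0 < tail i.
Proof. by rewrite tailS ltr_wpDr ?nb_pmf_gt0 ?mass_ge0. Qed.

Lemma tail_le i j : (i <= j)%N -> tail j <= tail i.
Proof.
move=> /subnK <-; elim: (j - i)%N => // k IH; rewrite (le_trans _ IH)//.
by rewrite (tailS (k + i)) addSn lerDr ltW ?nb_pmf_gt0.
Qed.

Lemma nb_cond_mean_indic m A : A `<=` Zge m ->
  nb_cond_mean r p m \1_A = mass A / tail m.
Proof.
move=> Am; rewrite /nb_cond_mean expectation_indic//= /nb_cond /mnormalize /=.
rewrite /mrestr setTI -massE eqe gt_eqF ?tail_gt0//=.
by rewrite setIidl// -massE.
Qed.

(** The shift k -> k + 1 turns the series of T(i+1) into that of T(i), and the
    inequality holds term by term: i w(j+1) <= p (r+i) w(j) for j >= i. *)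
Lemma tail_death_birth i : i%:R * tail i.+1 <= p * (r + i%:R) * tail i.
Proof.
have tailE j : nb_law r p (Zge j) = (\sum_(0 <= k <oo) (w (k + j))%:E)%E.
  rewrite nb_lawE nneseries_esumT => [|k]; last by rewrite lee_fin ltW ?nb_pmf_gt0.
  apply: (@reindex_esum R nat nat setT (Zge j) (addn^~ j)).
  split.
  - by move=> k _; rewrite /Zge/= leq_addl.
  - by move=> k l _ _ /addIn.
  - by move=> k jk; exists (k - j)%N => //; rewrite subnK.
have a0 : 0 <= p * (r + i%:R) by rewrite mulr_ge0 ?addr_ge0 // ltW.
rewrite -lee_fin !EFinM !massE !tailE -!nneseriesZl; last 2 first.
- by move=> k _; rewrite lee_fin ltW ?nb_pmf_gt0.
- by move=> k _; rewrite lee_fin ltW ?nb_pmf_gt0.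
apply: lee_nneseries => k _.
  by move=> _; rewrite mule_ge0 ?lee_fin// ltW ?nb_pmf_gt0.
rewrite -!EFinM lee_fin addnS.
have S0 : 0 < (k + i).+1%:R :> R by [].
rewrite -(ler_pM2l S0) mulrCA nb_pmfS.
move: (w (k + i)) (nb_pmf_gt0 (k + i)) => v v_gt0.
rewrite !mulrA ler_pM2r// -natr1 natrD.
have -> : ((k%:R + i%:R + 1) * p * (r + i%:R)) =
  i%:R * p * (r + (k%:R + i%:R)) + p * (r * (k%:R + 1) + i%:R) by ring.
by rewrite lerDl mulr_ge0 ?addr_ge0 ?mulr_ge0 ?addr_ge0// ltW.
Qed.

(** Induction on i: the birth rate grows by p and the death rate by 1 at each
    step, and p < 1.  A termwise comparison would fail at the last term. *)
Lemma head_birth_death m i : (m <= i)%N ->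
  p * (r + i%:R) * (tail m - tail i) <= i%:R * (tail m - tail i.+1).
Proof.
move=> /subnK <-; elim: (i - m)%N => [|k]; rewrite ?add0n ?addSn.
  by rewrite subrr mulr0 mulr_ge0// subr_ge0 tail_le.
set j := (k + m)%N => IH.
have mj : (m <= j)%N by exact: leq_addl.
have U0 : 0 <= tail m - tail j.+1 by rewrite subr_ge0 tail_le// ltnW.
have := tailS j; have := tailS j.+1; have := nb_pmfS j.
have : 0 <= (1 - p) * (tail m - tail j.+1) by rewrite mulr_ge0// subr_ge0 ltW.
rewrite -natr1 => h1 h2 h3 h4.
have h : p * (r + (j%:R + 1)) * (tail m - tail j.+1) =
  p * (r + j%:R) * (tail m - tail j) + p * (r + j%:R) * w j
  + p * (tail m - tail j.+1) by rewrite h4; ring.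
have -> : tail j.+2 = tail j.+1 - w j.+1 by rewrite h3; ring.
rewrite h -h2; lra.
Qed.

Lemma mass_le A B : A `<=` B -> mass A <= mass B.
Proof. by move=> AB; rewrite -lee_fin !massE le_measure ?inE. Qed.

Lemma mass_setC A i : mass (Zge i `\` A) = tail i - mass (A `&` Zge i).
Proof.
apply/eqP; rewrite eq_sym subr_eq; apply/eqP/EFin_inj.
by rewrite EFinD !massE setIC -measureDI.
Qed.

Lemma mass_head_ge0 A i : 0 <= mass A - mass (A `&` Zge i).
Proof. by rewrite subr_ge0 mass_le. Qed.

(** Passing to complements turns this into monotonicity of the mass. *)
Lemma mass_head_le m i A : (m <= i)%N -> A `<=` Zge m ->
  mass A - mass (A `&` Zge i) <= tail m - tail i.
Proof.
move=> mi Am; have : mass (Zge i `\` A) <= mass (Zge m `\` A).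
  by apply: mass_le => k [ik Ak]; split => //; exact: leq_trans ik.
by rewrite !mass_setC (setIidl Am); lra.
Qed.

Lemma mass_slice_bounds A i :
  0 <= mass (A `&` Zge i) - mass (A `&` Zge i.+1) <= w i.
Proof.
have w0 := nb_pmf_gt0 i.
by rewrite mass_capS addrK indicE; case: (_ \in _); rewrite ?mulr1 ?mulr0 lexx ltW.
Qed.

Lemma mass_point i : mass [set i] = w i /\
  forall j, mass ([set i] `&` Zge j) = if (j <= i)%N then w i else 0.
Proof.
have m1 : mass [set i] = w i.
  by rewrite /mass nb_lawE esum_set1// lee_fin ltW// nb_pmf_gt0.
split=> // j; case: ifPn => ji.
  by rewrite setIidl// => k ->.
rewrite (_ : _ `&` _ = set0) /mass ?measure0//.
by apply/seteqP; split => k //= -[->]; exact/negP.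
Qed.

(** * Solutions of Stein's equation *)

(** Weighting Stein's equation by w(i) makes it a first-order recursion whose
    unknown is i w(i) g(i), by detailed balance; the factor that kills the death
    term at m makes it start from 0. *)
Lemma stein_solutionE m A g : A `<=` Zge m -> stein_solution r p m \1_A g ->
  forall i, (m < i)%N ->
  i%:R * w i * g i = mass A * tail i / tail m - mass (A `&` Zge i).
Proof.
move=> Am gP; have T0 : tail m != 0 by rewrite gt_eqF ?tail_gt0.
elim=> // i IH; rewrite ltnS => mi.
have {gP} : w i * (p * (r + i%:R) * g i.+1 - i%:R * g i * (m < i)%N%:R) =
    w i * (\1_A i - nb_cond_mean r p m \1_A) by rewrite gP.
rewrite nb_cond_mean_indic// nb_pmfS.
move: mi; rewrite leq_eqVlt => /predU1P[mi|mi].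
  rewrite -mi ltnn => E.
  have -> : p * (r + m%:R) * w m * g m.+1 = w m * (\1_A m - mass A / tail m).
    by rewrite -E /=; ring.
  have := mass_capS A m; rewrite (setIidl Am) => E2.
  have -> : mass (A `&` Zge m.+1) = mass A - w m * \1_A m by rewrite [X in X - _]E2; ring.
  have -> : tail m.+1 = tail m - w m by rewrite (tailS m); ring.
  by field.
rewrite mi => E.
have -> : p * (r + i%:R) * w i * g i.+1 =
    i%:R * w i * g i + w i * (\1_A i - mass A / tail m).
  by rewrite -E /=; ring.
rewrite IH// mass_capS (tailS i).
by field.
Qed.

(** The modulus of g(i) for the indicator of [i, oo). *)
Definition stein_bound1 m i : R :=
  (tail m - tail i) * tail i / (i%:R * w i * tail m).

(** With a the mass of A before i and h the mass of A from i on, the numerator is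
    a T(i) - h (T(m) - T(i)), where 0 <= a <= T(m) - T(i) and 0 <= h <= T(i). *)
Lemma norm_stein_solution_le m A g i : A `<=` Zge m -> stein_solution r p m \1_A g ->
  (m < i)%N -> `|g i| <= stein_bound1 m i.
Proof.
move=> Am gP mi.
have i0 : 0 < i%:R :> R by rewrite ltr0n (leq_trans _ mi).
have wi0 := nb_pmf_gt0 i.
have T0 := tail_gt0 m.
have iw0 : 0 < i%:R * w i * tail m by rewrite mulr_gt0// mulr_gt0.
rewrite ler_pdivlMr// -(gtr0_norm iw0) -normrM.
have -> : g i * (i%:R * w i * tail m) = (i%:R * w i * g i) * tail m by ring.
rewrite (stein_solutionE Am gP mi) mulrBl divfK ?gt_eqF//.
have a0 := mass_head_ge0 A i.
have a1 := mass_head_le (ltnW mi) Am.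
have h0 := mass_ge0 (A `&` Zge i).
have h1 : mass (A `&` Zge i) <= tail i by apply: mass_le.
have Ti0 := tail_gt0 i.
move: (mass A) (mass (A `&` Zge i)) a0 a1 h0 h1 => q h a0 a1 h0 h1.
rewrite ler_norml; apply/andP; split.
  have : 0 <= (q - h) * tail i by rewrite mulr_ge0// ltW.
  have : 0 <= (tail m - tail i) * (tail i - h).
    by apply: mulr_ge0; [exact: le_trans a1|rewrite subr_ge0].
  lra.
have : 0 <= (tail m - tail i - (q - h)) * tail i.
  by apply: mulr_ge0; [rewrite subr_ge0|exact: ltW].
have : 0 <= (tail m - tail i) * h by apply: mulr_ge0 => //; exact: le_trans a1.
lra.
Qed.

Lemma norm_stein_solution_tail m g i : stein_solution r p m \1_(Zge i) g ->
  (m < i)%N -> `|g i| = stein_bound1 m i.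
Proof.
move=> gP mi.
have Am : Zge i `<=` Zge m by move=> k; apply: leq_trans; exact: ltnW.
have i0 : 0 < i%:R :> R by rewrite ltr0n (leq_trans _ mi).
have wi0 := nb_pmf_gt0 i.
have T0 := tail_gt0 m.
have iw0 : 0 < i%:R * w i by rewrite mulr_gt0.
have gE := stein_solutionE Am gP mi.
have -> : g i = - stein_bound1 m i.
  apply: (mulfI (lt0r_neq0 iw0)); rewrite gE setIid /stein_bound1 -/(tail i).
  by field; rewrite !gt_eqF.
rewrite normrN ger0_norm// divr_ge0 ?(ltW (mulr_gt0 iw0 T0))//.
by apply: mulr_ge0; [rewrite subr_ge0 tail_le// ltnW|exact: mass_ge0].
Qed.

(** The difference g(i+1) - g(i) for the indicator of {i}. *)
Definition stein_bound2 m i : R :=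
  i%:R^-1 - (tail i / i%:R - tail i.+1 / (p * (r + i%:R))) / tail m.

Lemma birth_tail_le_death_tail i : 0 < i%:R :> R ->
  tail i.+1 / (p * (r + i%:R)) - tail i / i%:R <= 0.
Proof.
move=> i0; have a0 : 0 < p * (r + i%:R) by rewrite mulr_gt0 ?addr_gt0.
rewrite subr_le0 ler_pdivrMr// mulrAC ler_pdivlMr//.
by have := tail_death_birth i; rewrite mulrC (mulrC (tail i)).
Qed.

Lemma stein_bound2_ge0 m i : (m < i)%N -> 0 <= stein_bound2 m i.
Proof.
move=> mi; have i0 : 0 < i%:R :> R by rewrite ltr0n (leq_trans _ mi).
have a0 : 0 < p * (r + i%:R) by rewrite mulr_gt0 ?addr_gt0.
have -> : stein_bound2 m i = ((tail m - tail i) / i%:R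
    + tail i.+1 / (p * (r + i%:R))) / tail m.
  by rewrite /stein_bound2; field; rewrite !gt_eqF ?tail_gt0// addr_gt0.
rewrite divr_ge0 ?mass_ge0// addr_ge0// divr_ge0 ?mass_ge0 ?(ltW i0) ?(ltW a0)//.
by rewrite subr_ge0 tail_le// ltnW.
Qed.

Section Difference.
Variables (m i : nat) (A : set nat) (g : nat -> R).
Hypotheses (mi : (m < i)%N) (Am : A `<=` Zge m) (gP : stein_solution r p m \1_A g).

Let i_gt0 : 0 < i%:R :> R. Proof. by rewrite ltr0n (leq_trans _ mi). Qed.
Let a_gt0 : 0 < p * (r + i%:R). Proof. by rewrite mulr_gt0 ?addr_gt0. Qed.
Let w_gt0 := nb_pmf_gt0 i.
Let T_gt0 := tail_gt0 m.

(** The three terms are the contributions of the parts of A before i, at i and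
    after i. *)
Lemma stein_diffE : (g i.+1 - g i) * (w i * tail m) =
  (mass A - mass (A `&` Zge i)) * (tail i.+1 / (p * (r + i%:R)) - tail i / i%:R)
  + (mass (A `&` Zge i) - mass (A `&` Zge i.+1)) * (stein_bound2 m i * tail m)
  + mass (A `&` Zge i.+1) * ((tail m - tail i) / i%:R
     - (tail m - tail i.+1) / (p * (r + i%:R))).
Proof.
have ri0 : r + i%:R != 0 by rewrite gt_eqF// addr_gt0.
have aw0 : p * (r + i%:R) * w i != 0 by rewrite gt_eqF// mulr_gt0.
have iw0 : i%:R * w i != 0 by rewrite gt_eqF// mulr_gt0.
have E := stein_solutionE Am gP mi.
have E' := stein_solutionE Am gP (ltnW mi : (m < i.+1)%N).
rewrite nb_pmfS in E'.
have -> : g i = (mass A * tail i / tail m - mass (A `&` Zge i)) / (i%:R * w i).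
  by rewrite -E mulrC mulKf.
have -> : g i.+1 = (mass A * tail i.+1 / tail m - mass (A `&` Zge i.+1))
    / (p * (r + i%:R) * w i).
  by rewrite -E' mulrC mulKf.
rewrite /stein_bound2.
by field; rewrite ri0 !gt_eqF.
Qed.

Let tail_coef_le0 :
  (tail m - tail i) / i%:R - (tail m - tail i.+1) / (p * (r + i%:R)) <= 0.
Proof.
rewrite subr_le0 ler_pdivrMr// mulrAC ler_pdivlMr//.
by have := head_birth_death (ltnW mi); rewrite mulrC (mulrC i%:R).
Qed.

(** The coefficients of the outer parts are nonpositive and the middle one is
    nonnegative, so the extreme values are at A = {i} and at its complement. *)
Lemma norm_stein_diff_le : `|g i.+1 - g i| <= stein_bound2 m i.
Proof.
have wT0 : 0 < w i * tail m by rewrite mulr_gt0.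
have b0 : 0 <= stein_bound2 m i * tail m.
  exact: mulr_ge0 (stein_bound2_ge0 mi) (ltW T_gt0).
rewrite -(ler_pM2r wT0) -[X in `|_| * X](gtr0_norm wT0) -normrM stein_diffE.
have -> : stein_bound2 m i * (w i * tail m) = w i * (stein_bound2 m i * tail m).
  by ring.
have a0 := mass_head_ge0 A i.
have a1 := mass_head_le (ltnW mi) Am.
have h0 := mass_ge0 (A `&` Zge i.+1).
have h1 : mass (A `&` Zge i.+1) <= tail i.+1 by apply: mass_le.
have /andP[c0 c1] := mass_slice_bounds A i.
(* The whole set [m, oo) has difference 0, so the complement of {i} gives the
   opposite of {i}. *)
have extremal : (tail m - tail i) * (tail i.+1 / (p * (r + i%:R)) - tail i / i%:R)
  + tail i.+1 * ((tail m - tail i) / i%:R - (tail m - tail i.+1) / (p * (r + i%:R)))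
  = - (w i * (stein_bound2 m i * tail m)).
  rewrite /stein_bound2 (tailS i).
  by field; rewrite !gt_eqF// addr_gt0.
have h1' := ler_wnM2r tail_coef_le0 h1.
have h0' := ler_wnM2r tail_coef_le0 h0.
have a1' := ler_wnM2r (birth_tail_le_death_tail i_gt0) a1.
have a0' := ler_wnM2r (birth_tail_le_death_tail i_gt0) a0.
have c1' := ler_wpM2r b0 c1.
have c0' := ler_wpM2r b0 c0.
rewrite !mul0r in h0' a0' c0'.
rewrite ler_norml -extremal; apply/andP; split; lra.
Qed.

End Difference.

Lemma norm_stein_diff_point m g i : stein_solution r p m \1_([set i]) g ->
  (m < i)%N -> `|g i.+1 - g i| = stein_bound2 m i.
Proof.
move=> gP mi.
have Am : [set i] `<=` Zge m by move=> k ->; exact: ltnW.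
have wT0 : 0 < w i * tail m by rewrite mulr_gt0 ?nb_pmf_gt0 ?tail_gt0.
have [m1 mZ] := mass_point i.
have -> : g i.+1 - g i = stein_bound2 m i.
  apply: (mulIf (lt0r_neq0 wT0)).
  by rewrite (stein_diffE mi Am gP) !mZ m1 leqnn ltnn; ring.
by rewrite ger0_norm// stein_bound2_ge0.
Qed.

(** * The Stein factors as explicit suprema *)

Lemma stein_factor1E m : stein_factor1 r p m =
  ereal_sup [set (stein_bound1 m i)%:E | i in Zge m.+1].
Proof.
apply/eqP; rewrite eq_le; apply/andP; split.
  apply: ge_ereal_sup => _ [g [f [A Am <-] gP] <-].
  apply: ge_ereal_sup => _ [i mi <-].
  apply: (@le_trans _ _ (stein_bound1 m i.+1)%:E).
    by rewrite lee_fin (norm_stein_solution_le Am gP).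
  by apply: ereal_sup_ubound; exists i.+1.
apply: ge_ereal_sup => _ [[//|i] mi <-].
have [g gP] := stein_solution_exists m \1_(Zge i.+1) r0 p0.
rewrite -(norm_stein_solution_tail gP mi).
apply: (@le_trans _ _ (shift_norm m g)).
  by apply: ereal_sup_ubound; exists i.
apply: ereal_sup_ubound; exists g => //; exists \1_(Zge i.+1) => //.
by exists (Zge i.+1) => // k; apply: leq_trans; exact: ltnW.
Qed.

Lemma stein_factor2E m : stein_factor2 r p m =
  ereal_sup [set (stein_bound2 m i)%:E | i in Zge m.+1].
Proof.
apply/eqP; rewrite eq_le; apply/andP; split.
  apply: ge_ereal_sup => _ [g [f [A Am <-] gP] <-].
  apply: ge_ereal_sup => _ [i mi <-].
  apply: (@le_trans _ _ (stein_bound2 m i.+1)%:E).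
    by rewrite lee_fin (norm_stein_diff_le _ Am gP).
  by apply: ereal_sup_ubound; exists i.+1.
apply: ge_ereal_sup => _ [[//|i] mi <-].
have [g gP] := stein_solution_exists m \1_([set i.+1]) r0 p0.
rewrite -(norm_stein_diff_point gP mi).
apply: (@le_trans _ _ (shift_norm m (fdiff g))).
  by apply: ereal_sup_ubound; exists i.
apply: ereal_sup_ubound; exists g => //; exists \1_([set i.+1]) => //.
by exists [set i.+1] => // k ->; exact: ltnW.
Qed.

Lemma stein_bound1_le m n i : (m <= n)%N -> (n < i)%N ->
  stein_bound1 n i <= stein_bound1 m i.
Proof.
move=> mn ni.
have i0 : 0 < i%:R :> R by rewrite ltr0n (leq_trans _ ni).
have T0 := tail_gt0.
have E k : stein_bound1 k i = (1 - tail i / tail k) * (tail i / (i%:R * w i)).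
  by rewrite /stein_bound1; field; rewrite !gt_eqF ?nb_pmf_gt0.
rewrite !E; apply: ler_wpM2r.
  by rewrite divr_ge0 ?mass_ge0// ltW// mulr_gt0// nb_pmf_gt0.
by rewrite lerB// ler_pM2l// lef_pV2 ?posrE// tail_le.
Qed.

(** The factor 1 / T(m) grows with m and is multiplied by a nonnegative
    bracket. *)
Lemma stein_bound2_le m n i : (m <= n)%N -> (n < i)%N ->
  stein_bound2 n i <= stein_bound2 m i.
Proof.
move=> mn ni.
have i0 : 0 < i%:R :> R by rewrite ltr0n (leq_trans _ ni).
rewrite /stein_bound2 lerD2l lerN2; apply: ler_wpM2l.
  by rewrite -oppr_le0 opprB birth_tail_le_death_tail.
by rewrite lef_pV2 ?posrE ?tail_gt0// tail_le.
Qed.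

Lemma ereal_sup_Zge_nonincreasing (b : nat -> nat -> R) :
  (forall m n i, (m <= n)%N -> (n < i)%N -> b n i <= b m i) ->
  nonincreasing_seq (fun m => ereal_sup [set (b m i)%:E | i in Zge m.+1]).
Proof.
move=> hb m n mn; apply: ge_ereal_sup => _ [i ni <-].
apply: (@le_trans _ _ (b m i)%:E); first by rewrite lee_fin hb.
by apply: ereal_sup_ubound; exists i => //; exact: leq_ltn_trans ni.
Qed.

End NegativeBinomial.

Theorem theorem4p5 (R : realType) (r p : R) (r_gt0 : 0 < r)
    (p_gt0 : 0 < p) (p_lt1 : p < 1) :
  nonincreasing_seq (stein_factor1 r p) /\ nonincreasing_seq (stein_factor2 r p).
Proof.
have E1 := funext (stein_factor1E r_gt0 p_gt0 p_lt1).
have E2 := funext (stein_factor2E r_gt0 p_gt0 p_lt1).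
by rewrite E1 E2; split; apply: ereal_sup_Zge_nonincreasing => m n i;
  [exact: stein_bound1_le|exact: stein_bound2_le].
Qed.
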